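(* Let $M_0$ be an r-framed, 2-ruled, Cayley cone in $\mathbb{R}^8$ defined by maps $\phi_1,\phi_2:\Sigma\to\mathcal{S}^7$ in the flat gauge, where $\Sigma$ is a Riemann surface. Let $w$ be a holomorphic vector field on $\Sigma$ and define $\psi:\Sigma\to\mathbb{R}^8$ by $\psi=\mathcal{L}_w\phi_1+\mathcal{L}_{iw}\phi_2$, where $\mathcal{L}_w,\mathcal{L}_{iw}$ denote the Lie derivatives with respect to $w,iw$. Let $$M=\{r_1\phi_1(\sigma)+r_2\phi_2(\sigma)+\psi(\sigma):r_1,r_2\in\mathbb{R},\ \sigma\in\Sigma\}.$$ Then $M$ is an r-framed 2-ruled Cayley 4-fold in $\mathbb{R}^8$.
   Context: Write $d\mathbf{x}_{ijkl}=dx_i\wedge dx_j\wedge dx_k\wedge dx_l$ and let $\Phi$ be the 4-form on $\mathbb{R}^8$ $$\Phi=d\mathbf{x}_{1234}+d\mathbf{x}_{1256}+d\mathbf{x}_{1278}+d\mathbf{x}_{1357}-d\mathbf{x}_{1368}-d\mathbf{x}_{1458}-d\mathbf{x}_{1467}+d\mathbf{x}_{5678}+d\mathbf{x}_{3478}+d\mathbf{x}_{3456}+d\mathbf{x}_{2468}-d\mathbf{x}_{2457}-d\mathbf{x}_{2367}-d\mathbf{x}_{2358}.$$ A 4-dimensional submanifold of $\mathbb{R}^8$ is Cayley if, for a suitable orientation, $\Phi$ restricts to the Riemannian volume form on each of its tangent spaces. The triple cross product on $\mathbb{R}^8$ is defined by $g(x\times y\times z,w)=\Phi(x,y,z,w)$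 for all $w$, with $g$ the Euclidean metric. A 2-ruled 4-fold is an (immersed) 4-dimensional submanifold with a smooth map $\pi:M\to\Sigma$ to a 2-manifold whose fibres are affine 2-planes; it is r-framed if an oriented orthonormal basis $(\phi_1(\sigma),\phi_2(\sigma))$ of each fibre direction is chosen smoothly. It is then the image of $\iota_M(r_1,r_2,\sigma)=r_1\phi_1(\sigma)+r_2\phi_2(\sigma)+\psi(\sigma)$ on $\mathbb{R}^2\times\Sigma$; singularities (points where $\iota_M$ is not an immersion) are allowed, and ''Cayley'' refers to the points where it is an immersion. The r-framed 2-ruled cone defined by the orthogonal smooth maps $\phi_1,\phi_2$ is $M_0=\{r_1\phi_1(\sigma)+r_2\phi_2(\sigma):\sigma\in\Sigma,\ r_1,r_2\in\mathbb{R}\}$. The complex structure of the Riemann surface $\Sigma$ is the one adapted to $M_0$: together with the flat gauge condition this means that for every local holomorphic coordinate $s+it$ on $\Sigma$, $$\frac{\partial\phi_j}{\partial t}=\phi_1\times\phi_2\times\frac{\partial\phi_j}{\partial s},\qquad \frac{\partial\phi_j}{\partial s}=-\phi_1\times\phi_2\times\frac{\partial\phi_j}{\partial t}\qquad (j=1,2).$$ A holomorphic vector field $w$ is regarded as a real vector field: locally $w=u\,\partial_s+v\,\partial_t$ with $u+iv$ holomorphic in $s+it$, and $iw=Jw=-v\,\partial_s+u\,\partial_t$. *)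

(* Defs.v *)
From HB Require Import structures.
From mathcomp Require Import all_boot all_order all_algebra.
From mathcomp Require Import all_classical all_reals all_analysis.

Set Implicit Arguments.
Unset Strict Implicit.
Unset Printing Implicit Defensive.
Import Order.TTheory GRing.Theory Num.Theory.
Import numFieldNormedType.Exports.
Local Open Scope classical_set_scope.
Local Open Scope ring_scope.

Section Euclidean8.
Variable R : realType.

Definition euclid (x y : 'rV[R]_8) : R := \sum_(i < 8) x 0 i * y 0 i.

(* The value of dx_i /\ dx_j /\ dx_k /\ dx_l on the rows of V; coordinates are
   numbered from 1 to 8. *)
Definition dx (i j k l : nat) (V : 'M[R]_(4, 8)) : R :=
  \det (\matrix_(a < 4, b < 4) V a (inord (nth 0%N [:: i; j; k; l] b).-1)).

Definition Phi (V : 'M[R]_(4, 8)) : R :=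
  dx 1 2 3 4 V + dx 1 2 5 6 V + dx 1 2 7 8 V + dx 1 3 5 7 V
  - dx 1 3 6 8 V - dx 1 4 5 8 V - dx 1 4 6 7 V
  + dx 5 6 7 8 V + dx 3 4 7 8 V + dx 3 4 5 6 V + dx 2 4 6 8 V
  - dx 2 4 5 7 V - dx 2 3 6 7 V - dx 2 3 5 8 V.

Definition rows4 (x y z w : 'rV[R]_8) : 'M[R]_(4, 8) :=
  \matrix_(a < 4) nth 0 [:: x; y; z; w] a.

(* The components of x * y * z in the standard basis; [cross3P] below is the
   defining property of the triple cross product. *)
Definition cross3 (x y z : 'rV[R]_8) : 'rV[R]_8 :=
  \row_(i < 8) Phi (rows4 x y z (delta_mx 0 i)).

Lemma dx_linear i j k l (x y z w : 'rV[R]_8) :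
  dx i j k l (rows4 x y z w) =
  \sum_(m < 8) dx i j k l (rows4 x y z (delta_mx 0 m)) * w 0 m.
Proof.
pose a3 : 'I_4 := ord_max.
rewrite /dx (expand_det_row _ a3).
under [RHS]eq_bigr => m _ do rewrite (expand_det_row _ a3) big_distrl /=.
rewrite exchange_big /=; apply: eq_bigr => b _.
rewrite !mxE /=; set h := inord _.
rewrite (bigD1 h)//= big1 ?addr0 => [|m /negbTE m_h]; last first.
  by rewrite !mxE /= eq_sym m_h !mul0r.
rewrite !mxE /= eqxx mul1r mulrC; congr (_ * _).
rewrite /cofactor; congr (_ * \det _).
apply/matrixP => a b'; rewrite !mxE.
have : (lift a3 a < 3)%N by rewrite lift_max; exact: ltn_ord.
by case: (nat_of_ord (lift a3 a)) => [|[|[|]]].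
Qed.

Lemma cross3P (x y z w : 'rV[R]_8) : euclid (cross3 x y z) w = Phi (rows4 x y z w).
Proof.
rewrite /euclid [RHS]/Phi; under eq_bigr => i _ do rewrite mxE /Phi !mulrDl !mulNr.
by rewrite !big_split /= !sumrN -!dx_linear.
Qed.

End Euclidean8.

(* The complex line C with coordinate s + it, as a real normed space. *)
Definition plane (R : realType) : normedModType R := (R^o * R^o)%type.

Section Calculus.
Variables (R : realType) (W : normedModType R).
Implicit Types (f : plane R -> W) (U : set (plane R)).

Definition ds f (z : plane R) : W := 'D_((1, 0) : plane R) f z.
Definition dt f (z : plane R) : W := 'D_((0, 1) : plane R) f z.

Definition dvec (a : plane R) f (z : plane R) : W := a.1 *: ds f z + a.2 *: dt f z.

Fixpoint Cn_on (n : nat) U f : Prop :=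
  match n with
  | 0 => forall z, U z -> {for z, continuous f}
  | n'.+1 => [/\ forall z, U z -> differentiable f z,
                 Cn_on n' U (ds f) & Cn_on n' U (dt f)]
  end.

Definition smooth_on U f : Prop := forall n, Cn_on n U f.

End Calculus.

Definition mul_i (R : realType) (a : plane R) : plane R := (- a.2, a.1).

(* Smooth functions satisfying the Cauchy-Riemann equation df/dt = i df/ds. *)
Definition holo_on (R : realType) (U : set (plane R)) (f : plane R -> plane R) :=
  smooth_on U f /\ forall z, U z -> dt f z = mul_i (ds f z).

(* Charts are total functions; only the values of [coord] on [cdom] and of
   [cinv] on [ccod] are meaningful. *)
Record chart (R : realType) (S : topologicalType) := Chart {
  cdom : set S;
  coord :> S -> plane R;
  cinv : plane R -> S;
  cdom_open : open cdom;
  ccod_open : open (coord @` cdom);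
  coordK : forall x, cdom x -> cinv (coord x) = x;
  coord_continuous : forall x, cdom x -> {for x, continuous coord};
  cinv_continuous : forall x, cdom x -> {for coord x, continuous cinv} }.

Definition ccod (R : realType) (S : topologicalType) (c : chart R S) :
  set (plane R) := c @` cdom c.

Definition holo_transition (R : realType) (S : topologicalType)
    (c c' : chart R S) : Prop :=
  holo_on (c @` (cdom c `&` cdom c')) (c' \o cinv c).

(* The atlas is maximal, so its charts are exactly the local holomorphic
   coordinates. *)
Record riemann_surface (R : realType) (S : topologicalType) := RiemannSurface {
  atlas : set (chart R S);
  atlas_cover : forall x, exists2 c, atlas c & cdom c x;
  atlas_holo : forall c c', atlas c -> atlas c' -> holo_transition c c';
  atlas_max : forall c,
    (forall c', atlas c' -> holo_transition c c' /\ holo_transition c' c) ->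
    atlas c;
  surface_hausdorff : hausdorff_space S;
  surface_second_countable : @second_countable S }.

Section Surface.
Variables (R : realType) (S : topologicalType) (X : riemann_surface R S).
Local Notation chart := (chart R S).
Local Notation plane := (plane R).
Local Notation R8 := 'rV[R]_8.

Definition chart_at (x : S) : chart := s2val (cid2 (atlas_cover X x)).

Definition smooth (f : S -> R8) : Prop :=
  forall c, atlas X c -> smooth_on (ccod c) (f \o cinv c).

(* A vector field is given by its components: [w c x = (u, v)] means that
   w = u d/ds + v d/dt at x, where s + it is the coordinate c. *)
Definition holo_vector_field (w : chart -> S -> plane) : Prop :=
  (forall c, atlas X c -> holo_on (ccod c) (w c \o cinv c)) /\
  (forall c c' x, atlas X c -> atlas X c' -> cdom c x -> cdom c' x ->
     w c' x = dvec (w c x) (c' \o cinv c) (c x)).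

Definition vf_i (w : chart -> S -> plane) : chart -> S -> plane :=
  fun c x => mul_i (w c x).

Definition lie (w : chart -> S -> plane) (f : S -> R8) (x : S) : R8 :=
  let c := chart_at x in dvec (w c x) (f \o cinv c) (c x).

Definition iota (phi1 phi2 psi : S -> R8) (p : plane * S) : R8 :=
  p.1.1 *: phi1 p.2 + p.1.2 *: phi2 p.2 + psi p.2.

(* Rows: the derivatives of F along r1, r2, s, t, where s + it = c. *)
Definition jac (c : chart) (F : plane * S -> R8) (p : plane * S) : 'M[R]_(4, 8) :=
  \matrix_(a < 4)
    'D_(nth (0 : plane * plane)
          [:: ((1, 0), (0, 0)); ((0, 1), (0, 0));
              ((0, 0), (1, 0)); ((0, 0), (0, 1))] a)
      (fun q : plane * plane => F (q.1, cinv c q.2)) (p.1, c p.2).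

Definition immersed_at (F : plane * S -> R8) (p : plane * S) : Prop :=
  exists c, [/\ atlas X c, cdom c p.2 & row_free (jac c F p)].

(* The holomorphic charts orient R^2 x Sigma, so an orientation of an open
   subset is a locally constant comparison [o] with that orientation ([true]
   meaning opposite). Phi restricts to the volume form iff it takes the value 1
   on every positively oriented orthonormal basis (the rows of E) of every
   tangent space (the row space of the Jacobian); such a basis exists only at
   points where F is an immersion. *)
Definition cayley (F : plane * S -> R8) : Prop :=
  exists o : plane * S -> bool,
    (forall p, immersed_at F p ->
       \forall q \near p, immersed_at F q -> o q = o p) /\
    (forall p c (A : 'M[R]_4), atlas X c -> cdom c p.2 ->
       let E := A *m jac c F p in
       E *m E^T = 1%:M -> 0 < (-1) ^+ o p * \det A -> Phi E = 1).

Record framed_2ruled (phi1 phi2 psi : S -> R8) (M : set R8) : Prop := {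
  framed_smooth1 : smooth phi1;
  framed_smooth2 : smooth phi2;
  framed_smooth : smooth psi;
  framed_unit1 : forall x, euclid (phi1 x) (phi1 x) = 1;
  framed_unit2 : forall x, euclid (phi2 x) (phi2 x) = 1;
  framed_orth : forall x, euclid (phi1 x) (phi2 x) = 0;
  framed_image : M = range (iota phi1 phi2 psi);
  (* M is 4-dimensional away from the singular points. *)
  framed_immersed : dense (immersed_at (iota phi1 phi2 psi)) }.

Definition framed_2ruled_cayley (phi1 phi2 psi : S -> R8) (M : set R8) : Prop :=
  framed_2ruled phi1 phi2 psi M /\ cayley (iota phi1 phi2 psi).

(* The complex structure is adapted to the cone and (phi1, phi2) is in the flat
   gauge. *)
Definition adapted_flat_gauge (phi1 phi2 : S -> R8) : Prop :=
  forall c x, atlas X c -> cdom c x ->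
  forall phi, phi = phi1 \/ phi = phi2 ->
    dt (phi \o cinv c) (c x) =
      cross3 (phi1 x) (phi2 x) (ds (phi \o cinv c) (c x)) /\
    ds (phi \o cinv c) (c x) =
      - cross3 (phi1 x) (phi2 x) (dt (phi \o cinv c) (c x)).

End Surface.

(* Main.v *)
From HB Require Import structures.
Require Import Defs.
From mathcomp Require Import all_boot all_order all_algebra.
From mathcomp Require Import all_classical all_reals all_analysis.
From mathcomp Require Import ring lra.

(* In a local holomorphic coordinate s + it, write x, y for the ruling
   directions of the cone, a, b for their s-derivatives and J v for
   [cross3 x y v], a complex structure on the orthogonal complement of x and y.
   The flat gauge says that L_(iv) f = J (L_v f) for f = x, y and every tangent
   vector v. For the translation part g = L_w x + L_(iw) y, expand g_t - J g_s:
   the derivatives of w contribute nothing, by the Cauchy-Riemann equation, and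
   as second derivatives commute what remains is the derivative of J along w,
   applied to a, plus that along iw, applied to b:
     alpha * y * a + x * beta * a + J alpha * y * b + x * J beta * b
   with alpha = L_w x and beta = L_w y. Modulo the span of x and y one has
   x * c * J d = y * c * d, so this sum vanishes. Every tangent space of M is
   therefore spanned by x, y, some z orthogonal to both and J z, and such a
   plane is Cayley because J is an isometry. *)

Set Implicit Arguments.
Unset Strict Implicit.
Unset Printing Implicit Defensive.
Import Order.TTheory GRing.Theory Num.Theory.
Import numFieldNormedType.Exports.
Local Open Scope classical_set_scope.
Local Open Scope ring_scope.

Section CayleyFormInCoordinates.
Variable K : comNzRingType.
Implicit Types x y z w a b : nat -> K.

Definition minor3 x y z i j k : K :=
  x i * (y j * z k - y k * z j) - x j * (y i * z k - y k * z i)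
  + x k * (y i * z j - y j * z i).

Definition minor4 x y z w i j k l : K :=
  minor3 x y z i j k * w l - minor3 x y z i j l * w k
  + minor3 x y z i k l * w j - minor3 x y z j k l * w i.

(* Coordinates are numbered from 1 to 8, as in [dx]. *)
Definition dot8 x y : K :=
  x 1 * y 1 + x 2 * y 2 + x 3 * y 3 + x 4 * y 4
  + x 5 * y 5 + x 6 * y 6 + x 7 * y 7 + x 8 * y 8.

Definition Phi8 x y z w : K :=
  let d := minor4 x y z w in
  d 1 2 3 4 + d 1 2 5 6 + d 1 2 7 8 + d 1 3 5 7
  - d 1 3 6 8 - d 1 4 5 8 - d 1 4 6 7
  + d 5 6 7 8 + d 3 4 7 8 + d 3 4 5 6 + d 2 4 6 8
  - d 2 4 5 7 - d 2 3 6 7 - d 2 3 5 8.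

Definition cross8 x y z (n : nat) : K := Phi8 x y z (fun m => (m == n)%:R).

Lemma Phi8_swap12 x y z w : Phi8 y x z w = - Phi8 x y z w.
Proof. by rewrite /Phi8 /minor4 /minor3; ring. Qed.

Lemma Phi8_swap23 x y z w : Phi8 x z y w = - Phi8 x y z w.
Proof. by rewrite /Phi8 /minor4 /minor3; ring. Qed.

Lemma Phi8_swap34 x y z w : Phi8 x y w z = - Phi8 x y z w.
Proof. by rewrite /Phi8 /minor4 /minor3; ring. Qed.

Lemma dot8_cross8 x y a b w :
  dot8 (cross8 x y a) (cross8 x b w) =
  dot8 x x * (dot8 y b * dot8 a w - dot8 y w * dot8 a b)
  - dot8 x b * (dot8 y x * dot8 a w - dot8 y w * dot8 a x)
  + dot8 x w * (dot8 y x * dot8 a b - dot8 y b * dot8 a x)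
  + (dot8 x x * Phi8 y a b w - dot8 x y * Phi8 x a b w
     - dot8 x a * Phi8 y x b w - dot8 x b * Phi8 y a x w
     - dot8 x w * Phi8 y a b x).
Proof. by rewrite /dot8 /cross8 /Phi8 /minor4 /minor3 /=; ring. Qed.

End CayleyFormInCoordinates.

Section FunctionMatrix.
Variable K : comNzRingType.

Definition det_fun n (f : nat -> nat -> K) :=
  \det (\matrix_(i < n, j < n) f i j).

Lemma det_fun_recl n f :
  det_fun n.+1 f =
  \sum_(k < n.+1)
    f 0 k * ((-1) ^+ k * det_fun n (fun i j => f i.+1 (bump k j))).
Proof.
rewrite /det_fun (expand_det_row _ ord0); apply: eq_bigr => k _.
rewrite mxE /cofactor.
by congr (_ * (_ * \det _)); apply/matrixP => i j; rewrite !mxE.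
Qed.

Lemma det_fun4 f :
  det_fun 4 f = minor4 (f 0) (f 1) (f 2) (f 3) 0 1 2 3.
Proof.
do 4 rewrite !det_fun_recl !big_ord_recl !big_ord0 /=.
by rewrite /det_fun !det_mx00 /minor4 /minor3 /bump /=; ring.
Qed.

End FunctionMatrix.

Section EuclideanProduct.
Variable R : realType.
Implicit Types x y z : 'rV[R]_8.

Lemma euclidC x y : euclid x y = euclid y x.
Proof. by apply: eq_bigr => i _; rewrite mulrC. Qed.

Lemma euclidDl x y z : euclid (x + y) z = euclid x z + euclid y z.
Proof. by rewrite -big_split; apply: eq_bigr => i _; rewrite mxE mulrDl. Qed.

Lemma euclidZl c x z : euclid (c *: x) z = c * euclid x z.
Proof. by rewrite mulr_sumr; apply: eq_bigr => i _; rewrite mxE mulrA. Qed.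

Lemma euclidNl x z : euclid (- x) z = - euclid x z.
Proof. by rewrite -scaleN1r euclidZl mulN1r. Qed.

Lemma euclid0l z : euclid 0 z = 0.
Proof. by apply: big1 => i _; rewrite mxE mul0r. Qed.

Lemma euclidDr x y z : euclid z (x + y) = euclid z x + euclid z y.
Proof. by rewrite euclidC euclidDl !(euclidC z). Qed.

Lemma euclidZr c x z : euclid z (c *: x) = c * euclid z x.
Proof. by rewrite euclidC euclidZl (euclidC z). Qed.

Lemma euclidNr x z : euclid z (- x) = - euclid z x.
Proof. by rewrite euclidC euclidNl (euclidC z). Qed.

Lemma euclid_delta x i : euclid x (delta_mx 0 i) = x 0 i.
Proof.
rewrite /euclid (bigD1 i)//= big1 ?addr0 ?mxE ?eqxx ?mulr1// => j ji.
by rewrite mxE (negbTE ji) andbF mulr0.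
Qed.

Lemma euclid_inj x y : (forall z, euclid x z = euclid y z) -> x = y.
Proof. by move=> xy; apply/rowP => i; rewrite -!euclid_delta. Qed.

Lemma euclid_ge0 x : 0 <= euclid x x.
Proof. by apply: sumr_ge0 => i _; exact: sqr_ge0. Qed.

Lemma euclid_eq0 x : (euclid x x == 0) = (x == 0).
Proof.
apply/idP/eqP => [|->]; last by rewrite euclid0l.
rewrite psumr_eq0 => [/allP x0|i _]; last exact: sqr_ge0.
apply/rowP => i; rewrite mxE; apply/eqP.
by rewrite -sqrf_eq0 expr2; apply: x0; exact: mem_index_enum.
Qed.

End EuclideanProduct.

Section TripleCrossProduct.
Variable R : realType.
Implicit Types x y z w a b : 'rV[R]_8.

Definition coord8 x (n : nat) : R := x 0 (inord n.-1).

Lemma euclidE x y : euclid x y = dot8 (coord8 x) (coord8 y).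
Proof.
transitivity (\sum_(i < 8) coord8 x i.+1 * coord8 y i.+1).
  by apply: eq_bigr => i _; rewrite /coord8 inord_val.
by do 8 rewrite big_ord_recr /=; rewrite big_ord0 add0r.
Qed.

Lemma dx_rows4 i j k l x y z w :
  dx i j k l (rows4 x y z w) =
  minor4 (coord8 x) (coord8 y) (coord8 z) (coord8 w) i j k l.
Proof.
pose entry (r c : nat) :=
  coord8 (nth 0 [:: x; y; z; w] r) (nth 0%N [:: i; j; k; l] c).
transitivity (det_fun 4 entry); last exact: det_fun4.
by congr (\det _); apply/matrixP => r c; rewrite !mxE.
Qed.

Lemma Phi_rows4 x y z w :
  Phi (rows4 x y z w) = Phi8 (coord8 x) (coord8 y) (coord8 z) (coord8 w).
Proof. by rewrite /Phi !dx_rows4. Qed.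

Lemma coord8_cross3 x y z n : (0 < n < 9)%N ->
  coord8 (cross3 x y z) n = cross8 (coord8 x) (coord8 y) (coord8 z) n.
Proof.
move=> n8; rewrite {1}/coord8 mxE Phi_rows4 /cross8.
have delta m : (0 < m < 9)%N ->
    coord8 (delta_mx 0 (inord n.-1) : 'rV[R]_8) m = (m == n)%:R.
  case: m n n8 => // m [] // n; rewrite /coord8 mxE eqxx -val_eqE /= !ltnS.
  by move=> n8 m8; rewrite !inordK // eqSS.
by rewrite /Phi8 /minor4 !delta.
Qed.

Lemma euclid_cross3 x y a b w : let e := @euclid R in
  e (cross3 x y a) (cross3 x b w) =
  e x x * (e y b * e a w - e y w * e a b)
  - e x b * (e y x * e a w - e y w * e a x)
  + e x w * (e y x * e a b - e y b * e a x)
  + (e x x * Phi (rows4 y a b w) - e x y * Phi (rows4 x a b w)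
     - e x a * Phi (rows4 y x b w) - e x b * Phi (rows4 y a x w)
     - e x w * Phi (rows4 y a b x)).
Proof.
rewrite /= !euclidE !Phi_rows4 -dot8_cross8.
by rewrite [in LHS]/dot8 !coord8_cross3.
Qed.

Lemma cross3_swap12 x y z : cross3 y x z = - cross3 x y z.
Proof. by apply/rowP => i; rewrite !mxE !Phi_rows4 Phi8_swap12. Qed.

Lemma cross3_swap23 x y z : cross3 x z y = - cross3 x y z.
Proof. by apply/rowP => i; rewrite !mxE !Phi_rows4 Phi8_swap23. Qed.

Lemma cross3_cyclic x y z : cross3 x y z = cross3 y z x.
Proof. by rewrite (cross3_swap23 y x z) (cross3_swap12 x y z) opprK. Qed.

Lemma euclid_cross3_swap x y z w :
  euclid (cross3 x y z) w = - euclid (cross3 x y w) z.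
Proof. by rewrite !cross3P !Phi_rows4 Phi8_swap34. Qed.

Lemma cross3_linear x y : linear (cross3 x y).
Proof.
move=> c z z'; apply: euclid_inj => w.
rewrite euclid_cross3_swap euclidDr euclidZr euclidDl euclidZl.
by rewrite !(euclid_cross3_swap x y _ w) opprD mulrN.
Qed.

HB.instance Definition _ x y :=
  GRing.isLinear.Build R 'rV[R]_8 'rV[R]_8 _ (cross3 x y) (@cross3_linear x y).

Lemma cross3Dr x y : {morph cross3 x y : z w / z + w}.
Proof. exact: linearD. Qed.

Lemma cross3Nr x y : {morph cross3 x y : z / - z}.
Proof. exact: linearN. Qed.

Lemma cross3Zr x y c : {morph cross3 x y : z / c *: z}.
Proof. exact: linearZ. Qed.

Lemma cross3_xyy x y : cross3 x y y = 0.
Proof.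
have /eqP := cross3_swap23 x y y.
by rewrite -addr_eq0 -mulr2n -scaler_nat scaler_eq0 pnatr_eq0 => /eqP.
Qed.

Lemma cross3_xyx x y : cross3 x y x = 0.
Proof. by rewrite cross3_cyclic cross3_xyy. Qed.

End TripleCrossProduct.

Section OrthonormalPair.
Variable R : realType.
Implicit Types x y z w a b : 'rV[R]_8.

Definition orthonormal x y :=
  [/\ euclid x x = 1, euclid y y = 1 & euclid x y = 0].

Definition perp x y a := euclid x a = 0 /\ euclid y a = 0.

Lemma orthonormalC x y : orthonormal x y -> orthonormal y x.
Proof. by move=> [xx yy xy]; split; rewrite // euclidC. Qed.

Lemma perpC x y a : perp x y a -> perp y x a.
Proof. by case. Qed.

Lemma perpN x y a : perp x y a -> perp x y (- a).
Proof. by move=> [xa ya]; split; rewrite euclidNr ?xa ?ya oppr0. Qed.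

Lemma perp_comb x y c d a b :
  perp x y a -> perp x y b -> perp x y (c *: a + d *: b).
Proof.
move=> [xa ya] [xb yb].
by split; rewrite euclidDr !euclidZr ?xa ?ya ?xb ?yb !mulr0 addr0.
Qed.

Definition perp_part x y z : 'rV[R]_8 := z - euclid x z *: x - euclid y z *: y.

Lemma perp_partD x y : {morph perp_part x y : z w / z + w}.
Proof.
move=> z w; rewrite /perp_part !euclidDr.
by apply/rowP => i; rewrite !mxE; ring.
Qed.

Lemma perp_partZ x y c : {morph perp_part x y : z / c *: z}.
Proof.
move=> z; rewrite /perp_part !euclidZr.
by apply/rowP => i; rewrite !mxE; ring.
Qed.

Lemma perp_partN x y : {morph perp_part x y : z / - z}.
Proof. by move=> z; rewrite -scaleN1r perp_partZ scaleN1r. Qed.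

Lemma perp_part_id x y a : perp x y a -> perp_part x y a = a.
Proof. by move=> [xa ya]; rewrite /perp_part xa ya !scale0r !subr0. Qed.

Lemma perp_partC x y a : perp_part y x a = perp_part x y a.
Proof. by rewrite /perp_part addrAC. Qed.

Lemma cross3_perp x y a : perp x y (cross3 x y a).
Proof.
by split; rewrite euclidC euclid_cross3_swap ?cross3_xyx ?cross3_xyy euclid0l
  oppr0.
Qed.

Lemma cross3_perp_part x y z : cross3 x y (perp_part x y z) = cross3 x y z.
Proof.
rewrite /perp_part !cross3Dr !cross3Nr !cross3Zr.
by rewrite cross3_xyx cross3_xyy !(oppr0, scaler0, addr0).
Qed.

Lemma perp_part_cross3ZD x y z c u a v b :
  perp_part x y (cross3 z c (u *: a + v *: b)) =
  u *: perp_part x y (cross3 z c a) + v *: perp_part x y (cross3 z c b).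
Proof. by rewrite cross3Dr !cross3Zr perp_partD !perp_partZ. Qed.

Lemma euclid_perp_partC x y z w :
  euclid (perp_part x y z) w = euclid z (perp_part x y w).
Proof.
rewrite /perp_part !(euclidDl, euclidNl, euclidZl).
rewrite !(euclidDr, euclidNr, euclidZr).
by rewrite (euclidC z x) (euclidC z y); ring.
Qed.

Variables x y : 'rV[R]_8.
Hypothesis orthonormal_xy : orthonormal x y.
Let xx : euclid x x = 1. Proof. by case: orthonormal_xy. Qed.
Let yy : euclid y y = 1. Proof. by case: orthonormal_xy. Qed.
Let xy : euclid x y = 0. Proof. by case: orthonormal_xy. Qed.
Let yx : euclid y x = 0. Proof. by rewrite euclidC. Qed.

Lemma perp_partP z : perp x y (perp_part x y z).
Proof.
split; rewrite /perp_part !(euclidDr, euclidNr, euclidZr).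
  by rewrite xx xy mulr1 mulr0 subrr subr0.
by rewrite yy yx mulr1 mulr0 subr0 subrr.
Qed.

Lemma perp_part_eq z z' :
  (forall w, perp x y w -> euclid z w = euclid z' w) ->
  perp_part x y z = perp_part x y z'.
Proof.
move=> zz'; apply: euclid_inj => w; rewrite !euclid_perp_partC.
by apply: zz'; exact: perp_partP.
Qed.

Lemma cross3_isometry a b : perp x y a ->
  euclid (cross3 x y a) (cross3 x y b) = euclid a b.
Proof.
move=> [xa ya]; rewrite euclid_cross3 xx xy yx yy (euclidC a x) (euclidC a y).
by rewrite xa ya -!cross3P cross3_xyx !euclid0l; ring.
Qed.

Lemma cross3_square a : perp x y a -> cross3 x y (cross3 x y a) = - a.
Proof.
move=> pa; apply: euclid_inj => w.
by rewrite euclid_cross3_swap euclidC cross3_isometry // euclidNl.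
Qed.

Lemma perp_part_cross3_l a b : perp x y a -> perp x y b ->
  perp_part x y (cross3 x b (cross3 x y a)) = perp_part x y (cross3 y b a).
Proof.
move=> [xa ya] [xb yb]; apply: perp_part_eq => w [xw yw].
rewrite euclid_cross3_swap euclidC euclid_cross3 (cross3_swap23 y a) euclidNl.
by rewrite xx xy yx xa xb yb xw yw -!cross3P; ring.
Qed.

End OrthonormalPair.

Section OrthonormalPairTwist.
Variables (R : realType) (x y : 'rV[R]_8).
Hypothesis orthonormal_xy : orthonormal x y.
Implicit Types a b : 'rV[R]_8.

Lemma perp_part_cross3_r a b : perp x y a -> perp x y b ->
  perp_part x y (cross3 y b (cross3 x y a)) = - perp_part x y (cross3 x b a).
Proof.
move=> pa pb; rewrite -!(perp_partC x y) (cross3_swap12 y x) cross3Nr.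
rewrite perp_partN.
congr (- _); apply: perp_part_cross3_l; [exact: orthonormalC|exact: perpC..].
Qed.

(* With a, b the s-derivatives of the directions x, y of a ruling in the flat
   gauge, [alpha] and [beta] are the derivatives of x and y along u + iv. *)
Lemma perp_part_flat_gauge_twist a b alpha beta (u v : R) :
  perp x y a -> perp x y b ->
  alpha = u *: a + v *: cross3 x y a -> beta = u *: b + v *: cross3 x y b ->
  perp_part x y (cross3 alpha y a + cross3 x beta a
    + (cross3 (cross3 x y alpha) y b + cross3 x (cross3 x y beta) b)) = 0.
Proof.
move=> pa pb alphaE betaE; pose P := perp_part x y.
have perp_twist c : perp x y c -> perp x y (u *: c + v *: cross3 x y c).
  by move=> pc; apply: perp_comb => //; exact: cross3_perp.
have palpha : perp x y alpha by rewrite alphaE; exact: perp_twist.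
have pbeta : perp x y beta by rewrite betaE; exact: perp_twist.
have P0 : P 0 = 0 by have := perp_partZ x y 0 0; rewrite !scale0r.
have alpha_y_a : P (cross3 alpha y a) = 0.
  rewrite cross3_cyclic alphaE /P perp_part_cross3ZD (perp_part_cross3_r pa pa).
  by rewrite !cross3_xyy -/P P0 oppr0 !scaler0 addr0.
have x_beta_a : P (cross3 x beta a) =
    - (u *: P (cross3 x a b) + v *: P (cross3 y a b)).
  rewrite cross3_swap23 betaE /P perp_partN perp_part_cross3ZD.
  by rewrite (perp_part_cross3_l orthonormal_xy pb pa).
have Jalpha_y_b : P (cross3 (cross3 x y alpha) y b) =
    u *: P (cross3 x a b) + v *: P (cross3 y a b).
  rewrite cross3_cyclic /P (perp_part_cross3_r palpha pb).
  rewrite alphaE perp_part_cross3ZD (perp_part_cross3_l orthonormal_xy pa pb).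
  rewrite (cross3_swap23 x a) (cross3_swap23 y a) !perp_partN.
  by rewrite !scalerN -opprD opprK.
have x_Jbeta_b : P (cross3 x (cross3 x y beta) b) = 0.
  rewrite cross3_swap23 /P perp_partN.
  rewrite (perp_part_cross3_l orthonormal_xy pbeta pb) betaE perp_part_cross3ZD.
  by rewrite (perp_part_cross3_r pb pb) !cross3_xyy -/P P0 oppr0 !scaler0 addr0
    oppr0.
rewrite !perp_partD -/P alpha_y_a x_beta_a Jalpha_y_b x_Jbeta_b.
by rewrite add0r addr0 addNr.
Qed.

End OrthonormalPairTwist.

Section CayleyPlanes.
Variable R : realType.
Implicit Types x y z : 'rV[R]_8.

Lemma Phi_mulmx (A : 'M[R]_4) (V : 'M[R]_(4, 8)) :
  Phi (A *m V) = \det A * Phi V.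
Proof.
have dx_mulmx i j k l : dx i j k l (A *m V) = \det A * dx i j k l V.
  rewrite /dx -det_mulmx; congr (\det _); apply/matrixP => r c.
  by rewrite !mxE; apply: eq_bigr => m _; rewrite !mxE.
by rewrite /Phi !dx_mulmx; ring.
Qed.

Lemma mulmx_trE m (V : 'M[R]_(m, 8)) i j :
  (V *m V^T) i j = euclid (row i V) (row j V).
Proof. by rewrite mxE; apply: eq_bigr => k _; rewrite !mxE. Qed.

Lemma row_mul_rows4 m (B : 'M[R]_(m, 4)) x y z w i :
  row i (B *m rows4 x y z w) =
  B i 0 *: x + B i 1 *: y + B i (inord 2) *: z + B i (inord 3) *: w.
Proof.
apply/rowP => k; rewrite !mxE; do 4 rewrite big_ord_recr /=.
rewrite big_ord0 add0r !mxE /=.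
by congr (B i _ * _ + B i _ * _ + B i _ * _ + B i _ * _);
  apply/val_inj; rewrite /= ?inordK.
Qed.

Lemma rows4_row_free_neq0 x y z w : row_free (rows4 x y z w) -> z != 0.
Proof.
move=> free; apply/eqP => z0; pose i2 : 'I_4 := inord 2.
have /(row_free_inj free)/matrixP/(_ 0 i2) :
    delta_mx 0 i2 *m rows4 x y z w = (0 : 'rV_4) *m rows4 x y z w.
  by rewrite -rowE mul0mx /rows4 rowK inordK.
by rewrite !mxE !eqxx => /eqP; rewrite oner_eq0.
Qed.

Variables x y z z' : 'rV[R]_8.
Hypothesis orthonormal_xy : orthonormal x y.
Hypothesis cayley_z' : perp_part x y z' = cross3 x y z.

Let V := rows4 x y z z'.
Let n := perp_part x y z.
Let W := rows4 x y n (cross3 x y n).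

Lemma cayley_plane_orthogonal_basis :
  exists2 B : 'M[R]_4, \det B = 1 & V = B *m W.
Proof.
pose B : 'M[R]_4 := \matrix_(i, j) nth 0 (nth [::] [:: [:: 1]; [:: 0; 1];
  [:: euclid x z; euclid y z; 1]; [:: euclid x z'; euclid y z'; 0; 1]] i) j.
exists B.
  rewrite det_trig.
    by rewrite !big_ord_recl big_ord0 !mxE /= !mulr1.
  apply/is_trig_mxP => i j; rewrite mxE.
  by case: i => [[|[|[|[|?]]]] ?] //; case: j => [[|[|[|[|?]]]] ?].
apply/row_matrixP => i; rewrite row_mul_rows4 /V rowK !mxE !inordK //=.
have decompose u : u = euclid x u *: x + euclid y u *: y + perp_part x y u.
  by rewrite /perp_part -(addrA u) -opprD [RHS]addrC subrK.
case: i => [[|[|[|[|?]]]] ?] //=; rewrite ?scale0r ?scale1r ?addr0 ?add0r //.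
by rewrite /n cross3_perp_part -cayley_z'; exact: decompose.
Qed.

Lemma cayley_plane_gram : \det (V *m V^T) = euclid n n ^+ 2.
Proof.
have [B detB ->] := cayley_plane_orthogonal_basis.
rewrite trmx_mul -mulmxA (mulmxA W) !det_mulmx det_tr detB mul1r mulr1.
have [xx yy xy] := orthonormal_xy.
have pn : perp x y n by exact: perp_partP.
have [[xn yn] [xJ yJ]] := (pn, cross3_perp x y n).
have nJ : euclid n (cross3 x y n) = 0.
  by rewrite euclidC; have := euclid_cross3_swap x y n n; lra.
have JJ : euclid (cross3 x y n) (cross3 x y n) = euclid n n.
  exact: cross3_isometry.
have -> : W *m W^T =
    diag_mx (\row_i nth 0 [:: 1; 1; euclid n n; euclid n n] i).
  apply/matrixP => i j; rewrite mulmx_trE !rowK 2!mxE.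
  case: i => [[|[|[|[|?]]]] ?] //; case: j => [[|[|[|[|?]]]] ?] //=;
  by rewrite ?mulr1n ?mulr0n // euclidC.
by rewrite det_diag !big_ord_recl big_ord0 !mxE /= !mul1r mulr1.
Qed.

Lemma Phi_cayley_plane : Phi V = euclid n n.
Proof.
have [B detB ->] := cayley_plane_orthogonal_basis.
rewrite Phi_mulmx detB mul1r -cross3P; apply: cross3_isometry => //.
exact: perp_partP.
Qed.

Lemma cayley_plane_row_free : perp_part x y z != 0 -> row_free V.
Proof.
rewrite -euclid_eq0 => n0; apply/row_freeP.
exists (V^T *m invmx (V *m V^T)); rewrite mulmxA mulmxV// unitmxE.
by rewrite cayley_plane_gram unitfE expf_neq0.
Qed.

Lemma cayley_plane_calibrated (A : 'M[R]_4) :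
  (A *m V) *m (A *m V)^T = 1%:M -> 0 < \det A -> Phi (A *m V) = 1.
Proof.
move=> /(congr1 determinant); rewrite det1 trmx_mul -mulmxA (mulmxA V).
rewrite !det_mulmx det_tr cayley_plane_gram => det_gram detA_gt0.
rewrite Phi_mulmx Phi_cayley_plane; apply/eqP.
rewrite -(@eqrXn2 _ 2) ?mulr_ge0 ?euclid_ge0 ?ltW// expr1n -det_gram.
by apply/eqP; ring.
Qed.

End CayleyPlanes.

Section Differentiability.
Variables (K : numFieldType) (T : normedModType K).
Implicit Types (v z : T).

Lemma near_eq_differentiable (W : normedModType K) (f g : T -> W) z :
  {near z, f =1 g} -> differentiable f z -> differentiable g z.
Proof.
move=> fg df.
have gE : g \o shift z = cst (g z) + 'd f z +o_ 0 id.
  have fgz := nbhs_singleton fg.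
  have fgs : \forall h \near 0, f (h + z) = g (h + z).
    by rewrite (near_shift z)/=; near do rewrite /= sub0r subrK.
  apply/eqaddoP => e e0; have /eqaddoP /(_ e e0) := diff_locally df.
  by apply: filterS2 fgs => h; rewrite !fctE /= -fgz => <-.
apply/diff_locallyP; rewrite (diff_unique (diff_continuous df) gE).
by split => //; exact: diff_continuous.
Unshelve. all: by end_near. Qed.

Section Linear.
Variables (W W' : normedModType K) (L : {linear W -> W'}).
Hypothesis continuous_L : continuous L.

Lemma derive_linear (v z : W) : 'D_v L z = L v.
Proof. by rewrite deriveE ?diff_lin//; exact: linear_differentiable. Qed.

Lemma differentiable_linear_comp (f : T -> W) z :
  differentiable f z -> differentiable (L \o f) z.
Proof.
by move=> df; apply: differentiable_comp => //; exact: linear_differentiable.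
Qed.

Lemma derive_linear_comp (f : T -> W) v z :
  differentiable f z -> 'D_v (L \o f) z = L ('D_v f z).
Proof.
move=> df; have dL : differentiable L (f z) by exact: linear_differentiable.
rewrite deriveE; last exact: differentiable_comp.
by rewrite (diff_comp _ dL)//= diff_lin// deriveE.
Qed.

Lemma derive_comp_linear (f : W' -> T) (v z : W) :
  differentiable f (L z) -> 'D_v (f \o L) z = 'D_(L v) f (L z).
Proof.
move=> df; have dL : differentiable L z by exact: linear_differentiable.
rewrite deriveE; last exact: differentiable_comp.
by rewrite (diff_comp dL)//= diff_lin// deriveE.
Qed.

End Linear.

Section Bilinear.
Variables (U V W : normedModType K) (B : {bilinear U -> V -> W}).
Hypothesis continuous_B : continuous (fun p => B p.1 p.2).
Variables (f : T -> U) (g : T -> V) (z : T).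
Hypotheses (df : differentiable f z) (dg : differentiable g z).

Lemma differentiable_bilin_comp : differentiable (fun y => B (f y) (g y)) z.
Proof.
pose dB := differentiable_bilin (f z, g z) continuous_B.
exact: (differentiable_comp (differentiable_pair df dg) dB).
Qed.

Lemma derive_bilin_comp v :
  'D_v (fun y => B (f y) (g y)) z = B (f z) ('D_v g z) + B ('D_v f z) (g z).
Proof.
rewrite deriveE; last exact: differentiable_bilin_comp.
have -> : (fun y => B (f y) (g y)) =
    (fun p => B p.1 p.2) \o (fun y => (f y, g y)) by [].
rewrite (diff_comp (differentiable_pair df dg)) /=.
  by rewrite diff_bilin// diff_pair//= !deriveE.
exact: differentiable_bilin.
Qed.

End Bilinear.

Lemma scale_is_bilinear (W : normedModType K) :
  bilinear_for *:%R *:%R (@GRing.scale K W).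
Proof.
split=> [w|k] a x y /=; first by rewrite scalerDl scalerA.
by rewrite scalerDr !scalerA mulrC.
Qed.

HB.instance Definition _ (W : normedModType K) :=
  bilinear_isBilinear.Build K K W W _ _ (@GRing.scale K W)
    (@scale_is_bilinear W).

Lemma differentiable_scale (W : normedModType K) (k : T -> K) (f : T -> W) z :
  differentiable k z -> differentiable f z ->
  differentiable (fun y => k y *: f y) z.
Proof. by apply: differentiable_bilin_comp; exact: scale_continuous. Qed.

Lemma derive_scale (W : normedModType K) (k : T -> K) (f : T -> W) v z :
  differentiable k z -> differentiable f z ->
  'D_v (fun y => k y *: f y) z = k z *: 'D_v f z + 'D_v k z *: f z.
Proof.
by move=> dk df; apply: derive_bilin_comp => //; exact: scale_continuous.
Qed.

End Differentiability.

Section MatrixContinuity.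
Variable K : numFieldType.

Lemma linear_mx_continuous m n (W : normedModType K)
  (L : {linear 'M[K]_(m, n) -> W}) : continuous L.
Proof.
have -> : L = (fun A => \sum_i \sum_j A i j *: L (delta_mx i j)) :> (_ -> _).
  apply/funext => A; rewrite {1}[A]matrix_sum_delta linear_sum.
  by apply: eq_bigr => i _; rewrite linear_sum; apply: eq_bigr => j _;
    rewrite linearZ.
move=> A; do 2 (apply: cvg_big => [||? _];
  [exact: add_continuous|exact: nbhs_filter|]).
by apply: cvgZr_tmp; [exact: nbhs_filter|exact: coord_continuous].
Qed.

Lemma bilinear_mx_continuous m n p q (W : normedModType K)
    (B : {bilinear 'M[K]_(m, n) -> 'M[K]_(p, q) -> W}) :
  continuous (fun u => B u.1 u.2).
Proof.
have -> : (fun u => B u.1 u.2) =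
    (fun u => \sum_i \sum_j u.1 i j *: B (delta_mx i j) u.2) :> (_ -> _).
  apply/funext => u; rewrite {1}[u.1]matrix_sum_delta linear_sumlz.
  by apply: eq_bigr => i _; rewrite linear_sumlz; apply: eq_bigr => j _;
    rewrite linearZl_LR.
move=> u; apply: cvg_big => [|i _]; first exact: add_continuous.
apply: cvg_big => [|j _]; first exact: add_continuous.
apply: cvgZ.
  apply: (@continuous_comp _ _ _ fst (fun A : 'M[K]_(m, n) => A i j)).
    exact: cvg_fst.
  exact: coord_continuous.
apply: (@continuous_comp _ _ _ snd (B (delta_mx i j))); first exact: cvg_snd.
exact: linear_mx_continuous.
Qed.

End MatrixContinuity.

Section SymmetryOfSecondDerivatives.
Variables (R : realType) (V : normedModType R).
Implicit Types (f : V -> R) (v w z : V) (a b h : R).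

Lemma is_derive_line f v z a : derivable f (a *: v + z) v ->
  is_derive a 1 (fun b => f (b *: v + z)) ('D_v f (a *: v + z)).
Proof.
have quotientE : (fun h => h^-1 *:
      (f ((h *: (1 : R) + a) *: v + z) - f (a *: v + z))) =
    (fun h => h^-1 *: (f (h *: v + (a *: v + z)) - f (a *: v + z))).
  apply/funext => h; congr (_ *: (f _ - _)).
  by rewrite [h *: 1]mulr1 scalerDl addrA.
move=> df; apply: DeriveDef; rewrite /derivable /derive /=.
  by rewrite [X in cvg (X @ _)]quotientE.
by rewrite [X in lim (X @ _)]quotientE.
Qed.

Lemma is_derive_MVT (k k' : R -> R) h : 0 <= h ->
  (forall a, 0 <= a <= h -> is_derive a 1 k (k' a)) ->
  exists2 a, 0 <= a <= h & k h - k 0 = h * k' a.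
Proof.
move=> h0 dk; have [||a] := @MVT_segment _ k k' 0 h h0.
- by move=> a; rewrite in_itv /= => /andP[a0 ah]; apply: dk; rewrite !ltW.
- apply: derivable_within_continuous => a; rewrite in_itv /= => ah.
  by case: (dk a ah).
- by rewrite in_itv /= subr0 mulrC; exists a.
Qed.

Definition second_difference f v w z h : R :=
  f (h *: v + (h *: w + z)) - f (h *: v + z) - (f (h *: w + z) - f z).

Lemma second_differenceC f v w z h :
  second_difference f v w z h = second_difference f w v z h.
Proof. by rewrite /second_difference addrCA; ring. Qed.

Lemma second_difference_MVT f v w z h : 0 <= h ->
  (forall a b, 0 <= a <= h -> 0 <= b <= h ->
     differentiable f (a *: v + (b *: w + z)) /\
     differentiable ('D_v f) (a *: v + (b *: w + z))) ->
  exists a b, [/\ 0 <= a <= h, 0 <= b <= h & second_difference f v w z h =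
    h ^+ 2 * 'D_w ('D_v f) (a *: v + (b *: w + z))].
Proof.
move=> h0 df; have h_in : 0 <= h <= h by rewrite h0 lexx.
have zero_in : 0 <= (0 : R) <= h by rewrite lexx.
pose g a := f (a *: v + (h *: w + z)) - f (a *: v + z).
have dg a : 0 <= a <= h -> is_derive a 1 g
    ('D_v f (a *: v + (h *: w + z)) - 'D_v f (a *: v + z)).
  move=> ah; apply: is_deriveB; apply: is_derive_line; apply: diff_derivable.
    exact: (df a h ah h_in).1.
  by have := (df a 0 ah zero_in).1; rewrite scale0r add0r.
have [a ah gE] := is_derive_MVT h0 dg.
pose k b := 'D_v f (b *: w + (a *: v + z)).
have dk b : 0 <= b <= h ->
    is_derive b 1 k ('D_w ('D_v f) (b *: w + (a *: v + z))).
  move=> bh; apply: is_derive_line; apply: diff_derivable.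
  by have := (df a b ah bh).2; rewrite addrCA.
have [b bh kE] := is_derive_MVT h0 dk.
exists a, b; split; [exact: ah|exact: bh|].
transitivity (g h - g 0); first by rewrite /g !scale0r !add0r.
rewrite gE [X in 'D_w _ X]addrCA expr2 -mulrA; congr (_ * _).
by rewrite -kE /k scale0r add0r addrCA.
Qed.

Lemma near_parallelogram (P : V -> Prop) v w z : (\forall y \near z, P y) ->
  \forall h \near (0 : R)^'+, forall a b, 0 <= a <= h -> 0 <= b <= h ->
    P (a *: v + (b *: w + z)).
Proof.
move=> near_z.
have affine : continuous (fun p : R * R => p.1 *: v + (p.2 *: w + z)).
  move=> p; apply: cvgD; [|apply: cvgD; last exact: cvg_cst];
    apply: cvgZr_tmp; [exact: cvg_fst|exact: cvg_snd].
have := affine (0 : R * R); rewrite /continuous_at /= !scale0r !add0r.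
move=> /(_ P near_z)/nbhs_ballP[d /= d0 dP]; near=> h => a b ah bh.
have hd : h < d by near: h; exact: nbhs_right_lt.
have ball_d c : 0 <= c <= h -> ball (0 : R) d c.
  move=> /andP[c0 ch]; rewrite -ball_normE /ball_ /= sub0r normrN.
  by rewrite ger0_norm// (le_lt_trans ch).
by apply: (dP (a, b)); split; exact: ball_d.
Unshelve. all: by end_near. Qed.

Lemma second_difference_cvg f v w z :
  (\forall y \near z, differentiable f y) ->
  (\forall y \near z, differentiable ('D_v f) y) ->
  {for z, continuous ('D_w ('D_v f))} ->
  h ^- 2 * second_difference f v w z h @[h --> 0^'+] --> 'D_w ('D_v f) z.
Proof.
move=> df dvf cf; apply/cvgrPdist_lt => e e0.
have /cvgrPdist_lt/(_ e e0)/(near_parallelogram v w) near_cf := cf.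
have near_df := near_parallelogram v w (filterI df dvf).
near=> h; have h0 : 0 < h by near: h; exact: nbhs_right_gt.
have [|a [b [ah bh ->]]] := @second_difference_MVT f v w z h (ltW h0).
  by near: h; exact: near_df.
rewrite mulKf ?expf_neq0 ?gt_eqF//.
by move: a b ah bh; near: h; exact: near_cf.
Unshelve. all: by end_near. Qed.

Lemma derive_commute f v w z :
  (\forall y \near z, differentiable f y) ->
  (\forall y \near z, differentiable ('D_v f) y) ->
  (\forall y \near z, differentiable ('D_w f) y) ->
  {for z, continuous ('D_w ('D_v f))} -> {for z, continuous ('D_v ('D_w f))} ->
  'D_w ('D_v f) z = 'D_v ('D_w f) z.
Proof.
move=> df dvf dwf cwv cvw.
have cvg_wv := second_difference_cvg df dvf cwv.
have cvg_vw := second_difference_cvg df dwf cvw.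
have swap : (fun h => h ^- 2 * second_difference f v w z h) =
    (fun h => h ^- 2 * second_difference f w v z h).
  by apply/funext => h; rewrite second_differenceC.
rewrite swap in cvg_wv; rewrite -(cvg_lim _ cvg_wv) //.
by rewrite (cvg_lim _ cvg_vw).
Qed.

End SymmetryOfSecondDerivatives.

Section CrossProductLeibniz.
Variables (R : realType) (T : normedModType R).

Definition cross3_mx (x y : 'rV[R]_8) : 'M[R]_8 := lin1_mx (cross3 x y).

Lemma mul_cross3_mx x y z : z *m cross3_mx x y = cross3 x y z.
Proof. exact: mul_rV_lin1. Qed.

Lemma cross3_mx_is_bilinear : bilinear_for *:%R *:%R cross3_mx.
Proof.
split=> [y|x] c a b; apply/row_matrixP => i; rewrite !rowE mulmxDr -scalemxAr.
  by rewrite !mul_cross3_mx !(cross3_cyclic _ y) cross3Dr cross3Zr.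
rewrite !mul_cross3_mx !(cross3_swap23 x (delta_mx 0 i)).
by rewrite cross3Dr cross3Zr opprD scalerN.
Qed.

HB.instance Definition _ :=
  bilinear_isBilinear.Build R 'rV[R]_8 'rV[R]_8 'M[R]_8 _ _ cross3_mx
    cross3_mx_is_bilinear.

Lemma derive_cross3 (f g h : T -> 'rV[R]_8) z v :
  differentiable f z -> differentiable g z -> differentiable h z ->
  'D_v (fun y => cross3 (f y) (g y) (h y)) z =
    cross3 ('D_v f z) (g z) (h z) + cross3 (f z) ('D_v g z) (h z)
    + cross3 (f z) (g z) ('D_v h z).
Proof.
move=> df dg dh.
have cont_cross3 : continuous (fun p => cross3_mx p.1 p.2).
  exact: bilinear_mx_continuous.
have cont_mul : continuous (fun p : 'rV[R]_8 * 'M[R]_8 => p.1 *m p.2).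
  exact: bilinear_mx_continuous.
have dfg := differentiable_bilin_comp cont_cross3 df dg.
have -> : (fun y => cross3 (f y) (g y) (h y)) =
    (fun y => h y *m cross3_mx (f y) (g y)).
  by apply/funext => y; rewrite mul_cross3_mx.
rewrite (derive_bilin_comp cont_mul dh dfg).
rewrite (derive_bilin_comp cont_cross3 df dg) /= mulmxDr !mul_cross3_mx.
by rewrite (addrC (cross3 (f z) ('D_v g z) (h z))).
Qed.

End CrossProductLeibniz.

Section SmoothnessClasses.
Variable R : realType.
Local Notation plane := (plane R).
Implicit Types (U : set plane) (V W : normedModType R) (z : plane).

Lemma open_near_eq (T : Type) U (f g : plane -> T) z : open U ->
  (forall z, U z -> f z = g z) -> U z -> {near z, f =1 g}.
Proof.
by move=> oU fg Uz; apply: filterS fg _; exact: open_nbhs_nbhs (conj oU Uz).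
Qed.

Lemma Cn_on_ext W n U (f g : plane -> W) : open U ->
  (forall z, U z -> f z = g z) -> Cn_on n U f -> Cn_on n U g.
Proof.
move=> oU; elim: n f g => [|n IH] f g fg /=.
  move=> cf z Uz; rewrite /prop_for /continuous_at -fg//.
  by apply: cvg_trans (cf z Uz); apply: near_eq_cvg; exact: open_near_eq fg Uz.
move=> [df sf tf]; split.
- move=> z Uz; apply: near_eq_differentiable (df z Uz).
  exact: open_near_eq fg Uz.
- by apply: IH sf => z Uz; apply: near_eq_derive; exact: open_near_eq fg Uz.
- by apply: IH tf => z Uz; apply: near_eq_derive; exact: open_near_eq fg Uz.
Qed.

Lemma Cn_onW W n U (f : plane -> W) : Cn_on n.+1 U f -> Cn_on n U f.
Proof.
elim: n f => [|n IH] f [df sf tf].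
  by move=> z Uz; exact/differentiable_continuous/df.
by split; [exact: df|exact: IH sf|exact: IH tf].
Qed.

Lemma Cn_onD W n U (f g : plane -> W) : open U ->
  Cn_on n U f -> Cn_on n U g -> Cn_on n U (fun z => f z + g z).
Proof.
move=> oU; elim: n f g => [|n IH] f g.
  by move=> cf cg z Uz; apply: continuousD; [exact: cf|exact: cg].
move=> [df sf tf] [dg sg tg].
have derive_add v z : U z -> 'D_v f z + 'D_v g z = 'D_v (f + g) z.
  move=> Uz; rewrite deriveD//; apply: diff_derivable.
    exact: df.
  exact: dg.
split.
- by move=> z Uz; apply: differentiableD; [exact: df|exact: dg].
- by apply: Cn_on_ext (IH _ _ sf sg) => // z; exact: derive_add.
- by apply: Cn_on_ext (IH _ _ tf tg) => // z; exact: derive_add.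
Qed.

Lemma Cn_on_linear_comp W W' (L : {linear W -> W'}) n U (f : plane -> W) :
  open U -> continuous L -> Cn_on n U f -> Cn_on n U (L \o f).
Proof.
move=> oU cL; elim: n f => [|n IH] f.
  by move=> cf z Uz; apply: continuous_comp; [exact: cf|exact: cL].
move=> [df sf tf].
have derive_L v z : U z -> L ('D_v f z) = 'D_v (L \o f) z.
  by move=> Uz; rewrite derive_linear_comp//; exact: df.
split.
- by move=> z Uz; apply: differentiable_linear_comp => //; exact: df.
- by apply: Cn_on_ext (IH _ sf) => // z; exact: derive_L.
- by apply: Cn_on_ext (IH _ tf) => // z; exact: derive_L.
Qed.

Lemma Cn_on_bilin_comp V V' W (B : {bilinear V -> V' -> W}) n U
    (f : plane -> V) (g : plane -> V') :
  open U -> continuous (fun p => B p.1 p.2) ->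
  Cn_on n U f -> Cn_on n U g -> Cn_on n U (fun z => B (f z) (g z)).
Proof.
move=> oU cB; elim: n f g => [|n IH] f g.
  move=> cf cg z Uz.
  apply: (@continuous_comp _ _ _ (fun z => (f z, g z)) (fun p => B p.1 p.2)).
    exact: cvg_pair (cf z Uz) (cg z Uz).
  exact: cB.
move=> Cf Cg; have [df sf tf] := Cf; have [dg sg tg] := Cg.
have derive_B v z : U z ->
    B (f z) ('D_v g z) + B ('D_v f z) (g z) = 'D_v (fun z => B (f z) (g z)) z.
  move=> Uz; rewrite derive_bilin_comp//.
    exact: df.
  exact: dg.
split.
- by move=> z Uz; apply: differentiable_bilin_comp => //; [exact: df|exact: dg].
- have sB := Cn_onD oU (IH _ _ (Cn_onW Cf) sg) (IH _ _ sf (Cn_onW Cg)).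
  by apply: Cn_on_ext sB => // z; exact: derive_B.
- have tB := Cn_onD oU (IH _ _ (Cn_onW Cf) tg) (IH _ _ tf (Cn_onW Cg)).
  by apply: Cn_on_ext tB => // z; exact: derive_B.
Qed.

Lemma smooth_on_differentiable W U (f : plane -> W) z :
  smooth_on U f -> U z -> differentiable f z.
Proof. by move=> /(_ 1) [df _ _]; exact: df. Qed.

Lemma smooth_on_ds W U (f : plane -> W) : smooth_on U f -> smooth_on U (ds f).
Proof. by move=> sf n; have [] := sf n.+1. Qed.

Lemma smooth_on_dt W U (f : plane -> W) : smooth_on U f -> smooth_on U (dt f).
Proof. by move=> sf n; have [] := sf n.+1. Qed.

Lemma ds_dt m n U (f : plane -> 'M[R]_(m, n)) z : open U -> smooth_on U f ->
  U z -> ds (dt f) z = dt (ds f) z.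
Proof.
move=> oU sf Uz; apply/matrixP => i j.
have entry_linear : linear (fun A : 'M[R]_(m, n) => A i j).
  by move=> c A B; rewrite !mxE.
pose entryM := GRing.isLinear.Build _ _ _ _ _ entry_linear.
pose entry : {linear 'M[R]_(m, n) -> R} :=
  HB.pack (fun A : 'M[R]_(m, n) => A i j) entryM.
have cont_entry : continuous entry by exact: coord_continuous.
have derive_entry v g y : smooth_on U g -> U y ->
    'D_v (entry \o g) y = entry ('D_v g y).
  move=> sg Uy; rewrite derive_linear_comp//.
  exact: smooth_on_differentiable Uy.
have smooth_entry : smooth_on U (entry \o f).
  by move=> k; exact: Cn_on_linear_comp.
have derive2_entry v v' : smooth_on U ('D_v' f) ->
    'D_v ('D_v' (entry \o f)) z = entry ('D_v ('D_v' f) z).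
  move=> sdf; rewrite -derive_entry//; apply: near_eq_derive.
  by apply: (open_near_eq oU) Uz => y Uy; exact: derive_entry.
apply: (etrans (esym (derive2_entry (1, 0) (0, 1) (smooth_on_dt sf)))).
apply: (etrans _ (derive2_entry (0, 1) (1, 0) (smooth_on_ds sf))).
have near_differentiable (g : plane -> R) : smooth_on U g ->
    \forall y \near z, differentiable g y.
  move=> sg; apply: filterS (open_nbhs_nbhs (conj oU Uz)) => y Uy.
  exact: smooth_on_differentiable Uy.
have ssf := smooth_on_ds smooth_entry; have stf := smooth_on_dt smooth_entry.
apply: derive_commute; [exact: near_differentiable..| |].
  exact: (smooth_on_ds stf 0).
exact: (smooth_on_dt ssf 0).
Qed.

End SmoothnessClasses.

Section DerivativesAlongFields.
Variable R : realType.
Local Notation plane := (plane R).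
Implicit Types (U : set plane) (V : normedModType R) (a z : plane).

Lemma dvecE V a (f : plane -> V) z :
  differentiable f z -> dvec a f z = 'D_a f z.
Proof.
move=> df; rewrite /dvec /ds /dt !deriveE// -!linearZ -linearD.
congr ('d f z _); case: a => u v; congr pair => /=.
  by rewrite [_ *: 1]mulr1 [_ *: 0]mulr0 addr0.
by rewrite [_ *: 1]mulr1 [_ *: 0]mulr0 add0r.
Qed.

Lemma near_eq_dvec V a (f g : plane -> V) z :
  {near z, f =1 g} -> dvec a f z = dvec a g z.
Proof. by move=> fg; rewrite /dvec /ds /dt !(near_eq_derive _ fg). Qed.

Lemma dvec_comp V a (T : plane -> plane) (f : plane -> V) z :
  differentiable T z -> differentiable f (T z) ->
  dvec a (f \o T) z = dvec (dvec a T z) f (T z).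
Proof.
move=> dT df; have dfT := differentiable_comp dT df.
rewrite (dvecE a dfT) (dvecE _ df) (dvecE a dT) (deriveE a dfT).
by rewrite (diff_comp dT df) (deriveE _ dT) (deriveE _ df).
Qed.

Lemma dvec_mul_i a (T : plane -> plane) z : dt T z = mul_i (ds T z) ->
  dvec (mul_i a) T z = mul_i (dvec a T z).
Proof.
rewrite /dvec => ->; case: a (ds T z) => [u v] [u' v'].
by congr pair; rewrite /= /GRing.scale /=; ring.
Qed.

Lemma mul_i_linear : linear (@mul_i R).
Proof.
move=> c [u v] [u' v']; congr pair; rewrite /= ?[_ *: _]/(_ * _) //.
by rewrite opprD -mulrN.
Qed.

HB.instance Definition _ :=
  GRing.isLinear.Build R plane plane _ (@mul_i R) mul_i_linear.

Lemma mul_i_continuous : continuous (@mul_i R).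
Proof.
move=> [u v].
have cvg_opp : - a.2 @[a --> ((u, v) : plane)] --> (- v : R^o).
  exact: (cvgN cvg_snd).
exact: (cvg_pair cvg_opp cvg_fst).
Qed.

Lemma smooth_on_mul_i U (w : plane -> plane) : open U ->
  smooth_on U w -> smooth_on U (fun z => mul_i (w z)).
Proof.
by move=> oU sw n; apply: Cn_on_linear_comp => //; exact: mul_i_continuous.
Qed.

Lemma smooth_on_dvec V U (w : plane -> plane) (f : plane -> V) : open U ->
  smooth_on U w -> smooth_on U f -> smooth_on U (fun z => dvec (w z) f z).
Proof.
move=> oU sw sf n.
have smooth_scale (p : {linear plane -> R}) (g : plane -> V) : continuous p ->
    smooth_on U g -> Cn_on n U (fun z => p (w z) *: g z).
  move=> cp sg; apply: Cn_on_bilin_comp => //; first exact: scale_continuous.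
  exact: Cn_on_linear_comp.
apply: Cn_onD => //.
  by apply: (smooth_scale fst); [move=> ?; exact: cvg_fst|exact: smooth_on_ds].
by apply: (smooth_scale snd); [move=> ?; exact: cvg_snd|exact: smooth_on_dt].
Qed.

Lemma derive_dvec V v (w : plane -> plane) (f : plane -> V) z :
  differentiable w z -> differentiable (ds f) z -> differentiable (dt f) z ->
  'D_v (fun z => dvec (w z) f z) z = dvec ('D_v w z) f z
    + ((w z).1 *: 'D_v (ds f) z + (w z).2 *: 'D_v (dt f) z).
Proof.
move=> dw dsf dtf.
have scaleE (p : {linear plane -> R}) (g : plane -> V) : continuous p ->
    differentiable g z -> is_derive z v (fun z => p (w z) *: g z)
      (p (w z) *: 'D_v g z + p ('D_v w z) *: g z).
  move=> cp dg; have dp := differentiable_linear_comp cp dw.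
  rewrite -(derive_linear_comp cp v dw) -(derive_scale v dp dg).
  exact/derivableP/diff_derivable/differentiable_scale.
have cfst : continuous (fst : plane -> R) by move=> ?; exact: cvg_fst.
have csnd : continuous (snd : plane -> R) by move=> ?; exact: cvg_snd.
have [_ ->] := is_deriveD (scaleE fst _ cfst dsf) (scaleE snd _ csnd dtf).
by rewrite /dvec [RHS]addrC addrACA.
Qed.

Lemma ds_dvec m n U (w : plane -> plane) (f : plane -> 'M[R]_(m, n)) z :
  open U -> smooth_on U w -> smooth_on U f -> U z ->
  ds (fun z => dvec (w z) f z) z = dvec (ds w z) f z + dvec (w z) (ds f) z.
Proof.
move=> oU sw sf Uz; rewrite {1}/ds derive_dvec.
- rewrite [in RHS]/dvec -(ds_dt oU sf Uz); exact: erefl.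
- exact: smooth_on_differentiable Uz.
- by apply: smooth_on_differentiable Uz; exact: smooth_on_ds.
- by apply: smooth_on_differentiable Uz; exact: smooth_on_dt.
Qed.

Lemma dt_dvec m n U (w : plane -> plane) (f : plane -> 'M[R]_(m, n)) z :
  open U -> smooth_on U w -> smooth_on U f -> U z ->
  dt (fun z => dvec (w z) f z) z = dvec (dt w z) f z + dvec (w z) (dt f) z.
Proof.
move=> oU sw sf Uz; rewrite {1}/dt derive_dvec.
- rewrite [in RHS]/dvec (ds_dt oU sf Uz); exact: erefl.
- exact: smooth_on_differentiable Uz.
- by apply: smooth_on_differentiable Uz; exact: smooth_on_ds.
- by apply: smooth_on_differentiable Uz; exact: smooth_on_dt.
Qed.

End DerivativesAlongFields.

Section TwistedRulingInChart.
Variables (R : realType) (U : set (plane R)) (x y : plane R -> 'rV[R]_8).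
Variable w : plane R -> plane R.
Implicit Types (f : plane R -> 'rV[R]_8) (a z : plane R).

Local Notation J z := (cross3 (x z) (y z)).

Definition flat_gauge_on f := forall z, U z ->
  dt f z = J z (ds f z) /\ ds f z = - J z (dt f z).

Hypothesis openU : open U.
Hypotheses (smooth_x : smooth_on U x) (smooth_y : smooth_on U y).
Hypothesis orthonormal_xy : forall z, U z -> orthonormal (x z) (y z).
Hypotheses (gauge_x : flat_gauge_on x) (gauge_y : flat_gauge_on y).
Hypothesis holo_w : holo_on U w.

Lemma flat_gauge_ds_perp f z : flat_gauge_on f -> U z ->
  perp (x z) (y z) (ds f z).
Proof. by move=> gauge_f /gauge_f[_ ->]; apply: perpN; exact: cross3_perp. Qed.

Lemma flat_gauge_dvec f a z : flat_gauge_on f -> U z ->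
  dvec a f z = a.1 *: ds f z + a.2 *: J z (ds f z).
Proof. by move=> gauge_f /gauge_f[dtE _]; rewrite /dvec dtE. Qed.

Lemma flat_gauge_dvec_mul_i f a z : flat_gauge_on f -> U z ->
  dvec (mul_i a) f z = J z (dvec a f z).
Proof.
move=> gauge_f Uz; have pf := flat_gauge_ds_perp gauge_f Uz.
rewrite !flat_gauge_dvec// cross3Dr !cross3Zr.
by rewrite (cross3_square (orthonormal_xy Uz) pf) scalerN scaleNr addrC.
Qed.

Lemma flat_gauge_dvec_dt f a z : flat_gauge_on f -> smooth_on U f -> U z ->
  dvec a (dt f) z = cross3 (dvec a x z) (y z) (ds f z)
    + cross3 (x z) (dvec a y z) (ds f z) + J z (dvec a (ds f) z).
Proof.
move=> gauge_f sf Uz.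
have diff (V : normedModType R) (g : plane R -> V) :
    smooth_on U g -> differentiable g z.
  by move=> sg; exact: smooth_on_differentiable Uz.
have [dx dy] := (diff _ x smooth_x, diff _ y smooth_y).
have [ddsf ddtf] := (diff _ _ (smooth_on_ds sf), diff _ _ (smooth_on_dt sf)).
have := derive_cross3 a dx dy ddsf.
rewrite -(dvecE a dx) -(dvecE a dy) -(dvecE a ddsf) => <-.
rewrite (dvecE a ddtf).
by apply: near_eq_derive; apply: open_near_eq Uz => // q /gauge_f[].
Qed.

Definition twist z := dvec (w z) x z + dvec (mul_i (w z)) y z.

Let smooth_w : smooth_on U w. Proof. exact: holo_w.1. Qed.
Let smooth_iw : smooth_on U (fun z => mul_i (w z)).
Proof. exact: smooth_on_mul_i. Qed.

Lemma smooth_on_twist : smooth_on U twist.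
Proof. by move=> n; apply: Cn_onD => //; exact: smooth_on_dvec. Qed.

Lemma derive_mul_i v z : U z ->
  'D_v (fun z => mul_i (w z)) z = mul_i ('D_v w z).
Proof.
move=> Uz; apply: derive_linear_comp; first exact: mul_i_continuous.
exact: smooth_on_differentiable smooth_w Uz.
Qed.

Lemma derive_twist v z : U z -> 'D_v twist z =
  'D_v (fun z => dvec (w z) x z) z + 'D_v (fun z => dvec (mul_i (w z)) y z) z.
Proof.
move=> Uz; apply: deriveD; apply: diff_derivable;
  by apply: smooth_on_differentiable Uz; exact: smooth_on_dvec.
Qed.

Lemma ds_twist z : U z -> ds twist z =
  dvec (ds w z) x z + dvec (w z) (ds x) z
  + (dvec (mul_i (ds w z)) y z + dvec (mul_i (w z)) (ds y) z).
Proof.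
move=> Uz; apply: etrans (derive_twist (1, 0) Uz) _; congr (_ + _).
  exact: ds_dvec Uz.
by rewrite -(derive_mul_i (1, 0) Uz); exact: ds_dvec Uz.
Qed.

Lemma dt_twist z : U z -> dt twist z =
  dvec (mul_i (ds w z)) x z + dvec (w z) (dt x) z
  + (dvec (mul_i (mul_i (ds w z))) y z + dvec (mul_i (w z)) (dt y) z).
Proof.
move=> Uz; apply: etrans (derive_twist (0, 1) Uz) _.
rewrite -(holo_w.2 z Uz); congr (_ + _); first exact: dt_dvec Uz.
by rewrite -(derive_mul_i (0, 1) Uz); exact: dt_dvec Uz.
Qed.

(* The first order terms cancel by the Cauchy-Riemann equation. *)
Lemma dt_twist_defect z : U z -> dt twist z = J z (ds twist z)
  + (cross3 (dvec (w z) x z) (y z) (ds x z)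
     + cross3 (x z) (dvec (w z) y z) (ds x z)
     + (cross3 (J z (dvec (w z) x z)) (y z) (ds y z)
        + cross3 (x z) (J z (dvec (w z) y z)) (ds y z))).
Proof.
move=> Uz; rewrite (dt_twist Uz).
have -> : J z (ds twist z) =
    dvec (mul_i (ds w z)) x z + J z (dvec (w z) (ds x) z)
    + (dvec (mul_i (mul_i (ds w z))) y z + J z (dvec (mul_i (w z)) (ds y) z)).
  rewrite (flat_gauge_dvec_mul_i _ gauge_x Uz).
  rewrite (flat_gauge_dvec_mul_i _ gauge_y Uz) (ds_twist Uz).
  by apply: etrans (cross3Dr _ _ _ _) _; congr (_ + _); exact: cross3Dr.
rewrite [X in _ + X + _ = _](flat_gauge_dvec_dt _ gauge_x smooth_x Uz).
rewrite [X in _ + (_ + X) = _](flat_gauge_dvec_dt _ gauge_y smooth_y Uz).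
rewrite (flat_gauge_dvec_mul_i (w z) gauge_x Uz).
rewrite (flat_gauge_dvec_mul_i (w z) gauge_y Uz).
have rearrange (p q p' q' d d' : 'rV[R]_8) :
    p + (d + q) + (p' + (d' + q')) = p + q + (p' + q') + (d + d').
  by rewrite (addrC d) (addrC d') !addrA -!(addrAC _ d) -addrA.
exact: rearrange.
Qed.

Lemma perp_part_dt_twist z : U z ->
  perp_part (x z) (y z) (dt twist z) = J z (ds twist z).
Proof.
move=> Uz; have [perp_ds_x perp_ds_y] := (flat_gauge_ds_perp gauge_x Uz,
  flat_gauge_ds_perp gauge_y Uz).
rewrite (dt_twist_defect Uz) perp_partD.
rewrite (perp_part_flat_gauge_twist (orthonormal_xy Uz) perp_ds_x perp_ds_y
  (flat_gauge_dvec _ gauge_x Uz) (flat_gauge_dvec _ gauge_y Uz)).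
by rewrite addr0 perp_part_id//; exact: cross3_perp.
Qed.

End TwistedRulingInChart.

Section RuledFamilies.
Variables (R : realType) (V W : normedModType R).

Lemma linear_affine_neq0_dense (L : {linear V -> W}) e (c : W) :
  L e != 0 -> dense [set q | L q + c != 0].
Proof.
move=> Le O [q Oq] openO.
have [Lqc|Lqc] := eqVneq (L q + c) 0; last by exists q.
have line : h *: e + q @[h --> (0 : R)] --> 0 *: e + q.
  by apply: cvgD; [apply: cvgZr_tmp; exact: cvg_id|exact: cvg_cst].
rewrite scale0r add0r in line.
have /line/nbhs_ballP[d /= d0 dO] : nbhs q O by exact: open_nbhs_nbhs.
have half_d_gt0 : 0 < d / 2 by rewrite divr_gt0.
exists (d / 2 *: e + q); split.
  apply: dO; rewrite -ball_normE /ball_ /= sub0r normrN gtr0_norm//.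
  by rewrite ltr_pdivrMr// ltr_pMr// ltr1n.
by rewrite /= linearD linearZ_LR -addrA Lqc addr0 scaler_eq0 negb_or Le gt_eqF.
Qed.

Definition plane_comb (a b : W) (q : plane R) : W := q.1 *: a + q.2 *: b.

Lemma plane_comb_linear a b : linear (plane_comb a b).
Proof.
move=> k [u v] [u' v'].
by rewrite /plane_comb /= !scalerDl scalerDr !scalerA addrACA.
Qed.

HB.instance Definition _ a b :=
  GRing.isLinear.Build R (plane R) W _ (plane_comb a b) (plane_comb_linear a b).

Lemma is_derive_comp_snd (U : normedModType R) (f : V -> W) (r v : U) z v' :
  differentiable f z ->
  is_derive ((r, z) : U * V) (v, v') (f \o snd) ('D_v' f z).
Proof.
have csnd : continuous (snd : U * V -> V) by move=> ?; exact: cvg_snd.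
move=> df; rewrite -(derive_comp_linear csnd (v, v') (z := (r, z))) //.
apply/derivableP/diff_derivable; apply: differentiable_comp => //.
exact: linear_differentiable.
Qed.

Lemma is_derive_fst_scale_snd (U : normedModType R) (p : {linear U -> R})
    (f : V -> W) (r v : U) z v' : continuous p -> differentiable f z ->
  is_derive ((r, z) : U * V) (v, v') (fun q => p q.1 *: f q.2)
    (p r *: 'D_v' f z + p v *: f z).
Proof.
move=> cp df; have cpfst : continuous (p \o fst : U * V -> R).
  by move=> q; apply: continuous_comp; [exact: cvg_fst|exact: cp].
have dp : differentiable (p \o fst : U * V -> R) (r, z).
  exact: linear_differentiable.
have dfs : differentiable (f \o snd : U * V -> W) (r, z).
  apply: differentiable_comp => //; apply: linear_differentiable => ?.
  exact: cvg_snd.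
have [_ <-] := is_derive_comp_snd r v v' df.
have <- : 'D_(v, v') (p \o fst) (r, z) = p v.
  exact: derive_linear cpfst (v, v') (r, z).
rewrite -[p r]/((p \o fst) (r, z)) -[f z]/((f \o snd) (r, z)).
rewrite -(derive_scale (v, v') dp dfs).
exact/derivableP/diff_derivable/differentiable_scale.
Qed.

Lemma derive_ruled (f1 f2 g : V -> W) (r v : plane R) z (v' : V) :
  differentiable f1 z -> differentiable f2 z -> differentiable g z ->
  'D_(v, v')
    (fun q : plane R * V => q.1.1 *: f1 q.2 + q.1.2 *: f2 q.2 + g q.2) (r, z) =
  v.1 *: f1 z + v.2 *: f2 z
  + (r.1 *: 'D_v' f1 z + r.2 *: 'D_v' f2 z + 'D_v' g z).
Proof.
move=> df1 df2 dg.
have cfst : continuous (fst : plane R -> R) by move=> ?; exact: cvg_fst.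
have csnd : continuous (snd : plane R -> R) by move=> ?; exact: cvg_snd.
have d1 := is_derive_fst_scale_snd (p := fst) r v v' cfst df1.
have d2 := is_derive_fst_scale_snd (p := snd) r v v' csnd df2.
have [_ ->] := is_deriveD (is_deriveD d1 d2) (is_derive_comp_snd r v v' dg).
by rewrite [RHS]addrA addrACA [X in X + _]addrC.
Qed.

End RuledFamilies.

Section LieDerivativesInCharts.
Variables (R : realType) (S : topologicalType) (X : riemann_surface R S).
Implicit Types (c : chart R S) (f : S -> 'rV[R]_8) (x : S).

Definition is_vector_field (w : chart R S -> S -> plane R) := forall c c' x,
  atlas X c -> atlas X c' -> cdom c x -> cdom c' x ->
  w c' x = dvec (w c x) (c' \o cinv c) (c x).

Lemma smooth_differentiable f c x : smooth X f -> atlas X c -> cdom c x ->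
  differentiable (f \o cinv c) (c x).
Proof.
by move=> sf ac cx; apply: smooth_on_differentiable (sf c ac) _; exists x.
Qed.

Lemma near_chart_transition (T : Type) (f : S -> T) c c' x :
  cdom c x -> cdom c' x ->
  {near c' x, f \o cinv c' =1 (f \o cinv c) \o (c \o cinv c')}.
Proof.
move=> cx c'x; have : nbhs (c' x) (cinv c' @^-1` cdom c).
  apply: (cinv_continuous c'x); apply: open_nbhs_nbhs; split.
    exact: cdom_open.
  by rewrite coordK.
by apply: filterS => z cz; rewrite /= coordK.
Qed.

Lemma dvec_change_chart f c c' x (a : plane R) :
  smooth X f -> atlas X c -> atlas X c' -> cdom c x -> cdom c' x ->
  dvec a (f \o cinv c') (c' x) =
  dvec (dvec a (c \o cinv c') (c' x)) (f \o cinv c) (c x).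
Proof.
move=> sf ac ac' cx c'x.
have transition_x : (c \o cinv c') (c' x) = c x by rewrite /= coordK.
have dtransition : differentiable (c \o cinv c') (c' x).
  by apply: smooth_on_differentiable (atlas_holo ac' ac).1 _; exists x.
have := smooth_differentiable sf ac cx; rewrite -transition_x => df.
apply: etrans _ (dvec_comp a dtransition df).
exact: near_eq_dvec (near_chart_transition f cx c'x).
Qed.

Lemma lie_chart w f c x : is_vector_field w -> smooth X f -> atlas X c ->
  cdom c x -> lie X w f x = dvec (w c x) (f \o cinv c) (c x).
Proof.
move=> vector_w sf ac cx; rewrite /lie /chart_at.
case: (cid2 _) => c' ac' c'x /=.
by rewrite (dvec_change_chart _ sf ac ac')// (vector_w c' c).
Qed.

Lemma vf_i_is_vector_field w :
  holo_vector_field X w -> is_vector_field (vf_i w).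
Proof.
move=> [_ vector_w] c c' x ac ac' cx c'x.
rewrite /vf_i (vector_w c c')// -dvec_mul_i//.
by apply: (atlas_holo ac ac').2; exists x.
Qed.

End LieDerivativesInCharts.

Section Ruling.
Variables (R : realType) (S : topologicalType).
Variables phi1 phi2 psi : S -> 'rV[R]_8.
Implicit Types (c : chart R S) (p : plane R * S).

Definition transverse (D : (plane R -> 'rV[R]_8) -> plane R -> 'rV[R]_8) c p :=
  p.1.1 *: D (phi1 \o cinv c) (c p.2) + p.1.2 *: D (phi2 \o cinv c) (c p.2)
  + D (psi \o cinv c) (c p.2).

Lemma jac_iota c p : cdom c p.2 ->
  differentiable (phi1 \o cinv c) (c p.2) ->
  differentiable (phi2 \o cinv c) (c p.2) ->
  differentiable (psi \o cinv c) (c p.2) ->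
  jac c (Defs.iota phi1 phi2 psi) p =
  rows4 (phi1 p.2) (phi2 p.2)
    (transverse (@ds R _) c p) (transverse (@dt R _) c p).
Proof.
case: p => [r x] /= cx d1 d2 dpsi.
have derive_iota v v' := derive_ruled r v v' d1 d2 dpsi.
apply/row_matrixP => i; rewrite /jac /rows4 !rowK /=.
by case: i => [[|[|[|[|?]]]] ?] //=; apply: etrans (derive_iota _ _) _ => /=;
  rewrite ?derive0 ?scaler0 ?addr0 coordK// ?scale0r ?scale1r ?addr0 ?add0r.
Qed.

End Ruling.

Section TwistedCone.
Variables (R : realType) (S : topologicalType) (X : riemann_surface R S).
Variables (phi1 phi2 : S -> 'rV[R]_8) (w : chart R S -> S -> plane R).
Implicit Types (c : chart R S) (p : plane R * S) (x : S).

Hypotheses (smooth1 : smooth X phi1) (smooth2 : smooth X phi2).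
Hypothesis orthonormal_phi : forall x, orthonormal (phi1 x) (phi2 x).
Hypothesis gauge : adapted_flat_gauge X phi1 phi2.
Hypothesis holo_w : holo_vector_field X w.

Let psi x := lie X w phi1 x + lie X (vf_i w) phi2 x.

Lemma flat_gauge_chart c : atlas X c ->
  flat_gauge_on (ccod c) (phi1 \o cinv c) (phi2 \o cinv c) (phi1 \o cinv c) /\
  flat_gauge_on (ccod c) (phi1 \o cinv c) (phi2 \o cinv c) (phi2 \o cinv c).
Proof.
move=> ac; split=> _ [x cx <-] /=; rewrite (coordK cx).
  by apply: (gauge ac cx (phi := phi1)); left.
by apply: (gauge ac cx (phi := phi2)); right.
Qed.

Lemma lie_sum_chart c z : atlas X c -> ccod c z ->
  psi (cinv c z) = twist (phi1 \o cinv c) (phi2 \o cinv c) (w c \o cinv c) z.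
Proof.
move=> ac [x cx <-]; rewrite /psi /twist /= (coordK cx).
rewrite (lie_chart holo_w.2 smooth1 ac cx).
by rewrite (lie_chart (vf_i_is_vector_field holo_w) smooth2 ac cx).
Qed.

Lemma smooth_lie_sum : smooth X psi.
Proof.
move=> c ac n; have openU : open (ccod c) by exact: ccod_open.
have smooth_w : holo_on (ccod c) (w c \o cinv c) := holo_w.1 c ac.
have smooth_twist := smooth_on_twist openU (smooth1 ac) (smooth2 ac) smooth_w.
apply: (Cn_on_ext openU _ (smooth_twist n)) => z Uz.
by rewrite /= lie_sum_chart.
Qed.

Lemma perp_part_dt_lie_sum c x : atlas X c -> cdom c x ->
  perp_part (phi1 x) (phi2 x) (dt (psi \o cinv c) (c x)) =
  cross3 (phi1 x) (phi2 x) (ds (psi \o cinv c) (c x)).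
Proof.
move=> ac cx; have openU : open (ccod c) by exact: ccod_open.
have Ux : ccod c (c x) by exists x.
have [gauge1 gauge2] := flat_gauge_chart ac.
have near_twist : {near c x, psi \o cinv c =1
    twist (phi1 \o cinv c) (phi2 \o cinv c) (w c \o cinv c)}.
  by apply: (open_near_eq openU _ Ux) => z Uz; exact: lie_sum_chart.
have dsE : ds (psi \o cinv c) (c x) = ds _ (c x) := near_eq_derive _ near_twist.
have dtE : dt (psi \o cinv c) (c x) = dt _ (c x) := near_eq_derive _ near_twist.
rewrite dsE dtE.
have := perp_part_dt_twist openU (smooth1 ac) (smooth2 ac)
  (fun z _ => orthonormal_phi (cinv c z)) gauge1 gauge2 (holo_w.1 c ac) Ux.
by rewrite /= (coordK cx).
Qed.

Lemma ds_phi_perp c x : atlas X c -> cdom c x ->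
  perp (phi1 x) (phi2 x) (ds (phi1 \o cinv c) (c x)) /\
  perp (phi1 x) (phi2 x) (ds (phi2 \o cinv c) (c x)).
Proof.
move=> ac cx; have Ux : ccod c (c x) by exists x.
have [gauge1 gauge2] := flat_gauge_chart ac.
have := flat_gauge_ds_perp gauge1 Ux; have := flat_gauge_ds_perp gauge2 Ux.
by rewrite /= (coordK cx).
Qed.

Lemma perp_part_transverse c p : atlas X c -> cdom c p.2 ->
  perp_part (phi1 p.2) (phi2 p.2) (transverse phi1 phi2 psi (@dt R _) c p) =
  cross3 (phi1 p.2) (phi2 p.2) (transverse phi1 phi2 psi (@ds R _) c p).
Proof.
move=> ac cx; set x := phi1 p.2; set y := phi2 p.2.
have perp_part_dt phi : phi = phi1 \/ phi = phi2 ->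
    perp_part x y (dt (phi \o cinv c) (c p.2)) =
    cross3 x y (ds (phi \o cinv c) (c p.2)).
  by move=> phiE; have [-> _] := gauge ac cx phiE;
    exact: perp_part_id (cross3_perp _ _ _).
apply: etrans (perp_partD x y _ _) _.
apply: etrans _ (esym (cross3Dr x y _ _)).
congr (_ + _); last exact: perp_part_dt_lie_sum.
apply: etrans (perp_partD x y _ _) _.
apply: etrans _ (esym (cross3Dr x y _ _)).
have perp_part_dtZ phi r : phi = phi1 \/ phi = phi2 ->
    perp_part x y (r *: dt (phi \o cinv c) (c p.2)) =
    cross3 x y (r *: ds (phi \o cinv c) (c p.2)).
  by move=> phiE; rewrite perp_partZ (perp_part_dt _ phiE) cross3Zr.
by congr (_ + _); apply: perp_part_dtZ; [left|right].
Qed.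

Lemma jac_iota_lie_sum c p : atlas X c -> cdom c p.2 ->
  jac c (Defs.iota phi1 phi2 psi) p = rows4 (phi1 p.2) (phi2 p.2)
    (transverse phi1 phi2 psi (@ds R _) c p)
    (transverse phi1 phi2 psi (@dt R _) c p).
Proof.
move=> ac cx; exact: (jac_iota cx (smooth_differentiable smooth1 ac cx)
  (smooth_differentiable smooth2 ac cx)
  (smooth_differentiable smooth_lie_sum ac cx)).
Qed.

Lemma cayley_lie_sum : cayley X (Defs.iota phi1 phi2 psi).
Proof.
exists (fun=> false); split; first by move=> p _; exact: filterE.
move=> p c A ac cx /=; rewrite (jac_iota_lie_sum ac cx) expr0 mul1r.
by apply: cayley_plane_calibrated => //; exact: perp_part_transverse.
Qed.

Lemma immersed_lie_sum c p : atlas X c -> cdom c p.2 ->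
  perp_part (phi1 p.2) (phi2 p.2)
    (transverse phi1 phi2 psi (@ds R _) c p) != 0 ->
  immersed_at X (Defs.iota phi1 phi2 psi) p.
Proof.
move=> ac cx transverse_neq0; exists c; split=> //.
rewrite (jac_iota_lie_sum ac cx).
by apply: cayley_plane_row_free => //; exact: perp_part_transverse.
Qed.

Lemma cone_transverse_neq0 c p : atlas X c -> cdom c p.2 ->
  row_free (jac c (Defs.iota phi1 phi2 (fun=> 0)) p) ->
  plane_comb (ds (phi1 \o cinv c) (c p.2)) (ds (phi2 \o cinv c) (c p.2)) p.1
    != 0.
Proof.
move=> ac cx.
have d0 : differentiable ((fun=> 0 : 'rV[R]_8) \o cinv c) (c p.2).
  exact: differentiable_cst.
rewrite (jac_iota cx (smooth_differentiable smooth1 ac cx)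
  (smooth_differentiable smooth2 ac cx) d0).
move=> /rows4_row_free_neq0; rewrite /transverse.
have -> : ds ((fun=> 0 : 'rV[R]_8) \o cinv c) (c p.2) = 0 by exact: derive_cst.
by rewrite addr0.
Qed.

(* Along a fibre of the cone the transverse derivative is linear in the fibre
   coordinates, and translating the fibre only adds a constant to it. *)
Lemma dense_immersed_lie_sum :
  dense (immersed_at X (Defs.iota phi1 phi2 (fun=> 0))) ->
  dense (immersed_at X (Defs.iota phi1 phi2 psi)).
Proof.
move=> dense_cone O O0 openO.
have [[r x] [Orx [c [ac cx cone_free]]]] := dense_cone O O0 openO.
have comb_r_neq0 := cone_transverse_neq0 ac cx cone_free.
have [perp_a perp_b] := ds_phi_perp ac cx.
set a := ds _ _ in comb_r_neq0 perp_a; set b := ds _ _ in comb_r_neq0 perp_b.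
pose shift := perp_part (phi1 x) (phi2 x) (ds (psi \o cinv c) (c x)).
have open_slice : open [set q | O (q, x)].
  apply: open_comp openO => q _.
  exact: (cvg_pair cvg_id (cvg_cst x)).
have [q [Oqx comb_q_neq0]] := @linear_affine_neq0_dense _ _ _ (plane_comb a b) r
  shift comb_r_neq0 _ (ex_intro _ r Orx) open_slice.
exists (q, x); split; first exact: Oqx.
apply: (immersed_lie_sum (p := (q, x)) ac cx).
have -> : perp_part (phi1 x) (phi2 x)
    (transverse phi1 phi2 psi (@ds R _) c (q, x)) = plane_comb a b q + shift.
  apply: etrans (perp_partD _ _ _ _) _; congr (_ + _).
  exact: perp_part_id (perp_comb _ _ perp_a perp_b).
exact: comb_q_neq0.
Qed.

End TwistedCone.

Theorem theorem4p10 (R : realType) (S : topologicalType)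
    (X : riemann_surface R S) (phi1 phi2 : S -> 'rV[R]_8)
    (w : chart R S -> S -> plane R) (psi : S -> 'rV[R]_8)
    (M0 M : set 'rV[R]_8) :
  M0 = [set y | exists (r1 r2 : R) (x : S), y = r1 *: phi1 x + r2 *: phi2 x] ->
  framed_2ruled_cayley X phi1 phi2 (fun _ => 0) M0 ->
  adapted_flat_gauge X phi1 phi2 ->
  holo_vector_field X w ->
  psi = (fun x => lie X w phi1 x + lie X (vf_i w) phi2 x) ->
  M = [set y | exists (r1 r2 : R) (x : S),
               y = r1 *: phi1 x + r2 *: phi2 x + psi x] ->
  framed_2ruled_cayley X phi1 phi2 psi M.
Proof.
move=> _ [[smooth1 smooth2 _ unit1 unit2 orth _ dense_cone] _].
move=> gauge holo_w -> ->.
have orthonormal_phi x : orthonormal (phi1 x) (phi2 x) by split.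
split; last exact: cayley_lie_sum.
split.
- exact: smooth1.
- exact: smooth2.
- exact: smooth_lie_sum.
- exact: unit1.
- exact: unit2.
- exact: orth.
- apply/seteqP; split=> [y [r1 [r2 [x ->]]]|y [[[r1 r2] x] _ <-]].
    by exists ((r1, r2), x).
  by exists r1, r2, x.
- exact: dense_immersed_lie_sum.
Qed.
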